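(* Let $k\ge1$ and $T\ge 2$ be integers, let $\mathcal D_1,\dots,\mathcal D_T$ be task distributions, let $f_1,\dots,f_T$ be arbitrary encoders, let $\lambda>0$, and for each $t\in\{2,\dots,T\}$ let $k_{t1},\dots,k_{t,t-1}>0$ with $\sum_{j=1}^{t-1}k_{tj}=1$. Set $\alpha=\frac{2e^2}{k+e^2}$, $\gamma_t(\lambda)=\min\big(\{\tfrac1t\}\cup\{\lambda k_{tj}\}_{j=1}^{t-1}\big)$ and $\gamma'_t(\lambda)=\max\big(\{1\}\cup\{\lambda k_{tj}\}_{j=1}^{t-1}\big)$. Then, with all losses being the $k$-negative ones, $$L_{\mathrm{test}}(f_T;\mathcal D_1,\dots,\mathcal D_T)\le \alpha^{T-1}L_{\mathrm{train}}(f_1;\mathcal D_1)+\sum_{t=2}^T\frac{\alpha^{T-t}}{\gamma_t(\lambda)}L_{\mathrm{train}}(f_t;f_{t-1},\mathcal D_t,\mathcal D_{1:t-1})+\eta,$$ $$L_{\mathrm{test}}(f_T;\mathcal D_1,\dots,\mathcal D_T)\ge \alpha^{T-1}L_{\mathrm{train}}(f_1;\mathcal D_1)+\sum_{t=2}^T\frac{\alpha^{T-t}}{\gamma'_t(\lambda)}L_{\mathrm{train}}(f_t;f_{t-1},\mathcal D_t,\mathcal D_{1:t-1})+\eta',$$ where $$\eta=\Big(2-\alpha+\alpha\log\tfrac{\alpha}{2}\Big)\frac{T-1-T\alpha+\alpha^T}{(1-\alpha)^2}+\sum_{t=2}^T\alpha^{T-t}\Big(1-\frac{1}{\gamma_t(\lambda)}\Big)\inf_f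 L^{(k)}_{\mathrm{con}}(f;\mathcal D_t),$$ $$\eta'=-\Big(\alpha\log(1+ke^2)+\frac{2ke^2}{1+ke^2}\Big)\frac{T-1-T\alpha+\alpha^T}{(1-\alpha)^2},$$ the infimum being over all encoders $f$.
   Context: Let $\mathcal X$ be a measurable input space and $d\ge 1$. An encoder is a measurable map $f:\mathcal X\to\mathbb R^d$ with $\|f(x)\|_2=1$ for all $x$. A task distribution $\mathcal D$ consists of a probability distribution $\mu$ on a countable set of classes together with, for each class $c$, a probability distribution $\mathcal D_c$ on $\mathcal X$. $k$-negative sampling scheme: $c^+,c_1^-,\dots,c_k^-\sim\mu$ independently; given $c^+$, $x,x^+$ are drawn i.i.d. from $\mathcal D_{c^+}$; independently, $x_i^-\sim\mathcal D_{c_i^-}$ for $i=1,\dots,k$. For $\mathbf v\in\mathbb R^k$ let $\ell(\mathbf v)=\log\big(1+\sum_{i=1}^k e^{-v_i}\big)$. The $k$-negative contrastive loss is $L^{(k)}_{\mathrm{con}}(f;\mathcal D)=\mathbb E\big[\ell\big((f(x)^\top(f(x^+)-f(x_i^-)))_{i=1}^k\big)\big]$. Let $\mathbf p(f;x,x^+,x_1^-,\dots,x_k^-)=\mathrm{softmax}\big(f(x)^\top f(x^+),f(x)^\top f(x_1^-),\dots,f(x)^\top f(x_k^-)\big)\in\mathbb R^{k+1}$, and for encoders $g,h$ let $L^{(k)}_{\mathrm{dis}}(g;h,\mathcal D)=\mathbb E\big[-\mathbf p(h;x,x^+,x_1^-,\dots,x_k^-)\cdot\log\mathbf p(g;x,x^+,x_1^-,\dots,x_k^-)\big]$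 under the same sampling scheme. For $t\ge2$, $L^{(k)}_{\mathrm{dis}}(f_t;f_{t-1},\mathcal D_{1:t-1}):=\sum_{j=1}^{t-1}k_{tj}L^{(k)}_{\mathrm{dis}}(f_t;f_{t-1},\mathcal D_j)$. Training losses: $L_{\mathrm{train}}(f_1;\mathcal D_1)=L^{(k)}_{\mathrm{con}}(f_1;\mathcal D_1)$ and, for $t\ge2$, $L_{\mathrm{train}}(f_t;f_{t-1},\mathcal D_t,\mathcal D_{1:t-1})=L^{(k)}_{\mathrm{con}}(f_t;\mathcal D_t)+\lambda L^{(k)}_{\mathrm{dis}}(f_t;f_{t-1},\mathcal D_{1:t-1})$. Test loss: $L_{\mathrm{test}}(f_T;\mathcal D_1,\dots,\mathcal D_T)=\sum_{t=1}^T L^{(k)}_{\mathrm{con}}(f_T;\mathcal D_t)$. *)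

(* Defs.v *)
From HB Require Import structures.
From mathcomp Require Import all_boot all_order all_algebra.
From mathcomp Require Import all_classical all_reals all_analysis.
Set Implicit Arguments. Unset Strict Implicit. Unset Printing Implicit Defensive.
Import Order.TTheory GRing.Theory Num.Theory.
Local Open Scope classical_set_scope.
Local Open Scope ring_scope.

Section ContrastiveDefs.
Variables (R : realType) (dX : measure_display) (X : measurableType dX) (d : nat).

Definition is_encoder (f : 'I_d -> X -> R) : Prop :=
  (forall i, measurable_fun setT (f i)) /\
  (forall x, \sum_(i < d) (f i x) ^+ 2 = 1).

Definition dotE (f : 'I_d -> X -> R) (x : X) (g : 'I_d -> X -> R) (y : X) : R :=
  \sum_(i < d) f i x * g i y.

(* A task distribution: a probability mu on a countable set of classes
   (encoded in nat, with the discrete sigma-algebra) and, for each class c,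
   a probability D_c on X. *)
Record task := Task { cls : probability nat R ; cdist : nat -> probability X R }.

Local Open Scope ereal_scope.

(* Expectation over n i.i.d. negatives x_i^- ~ D_{c_i^-}, c_i^- ~ mu,
   written as iterated integrals (the scheme is a product law). *)
Fixpoint negE (D : task) (n : nat) (G : seq X -> \bar R) : \bar R :=
  match n with
  | 0%N => G [::]
  | n'.+1 => \int[cls D]_c \int[cdist D c]_y negE D n' (fun s => G (y :: s))
  end.

Definition Esample (k : nat) (D : task) (F : X -> X -> seq X -> \bar R) : \bar R :=
  \int[cls D]_c \int[cdist D c]_x \int[cdist D c]_xp
     negE D k (fun s => F x xp s).

Local Close Scope ereal_scope.

Definition con_integrand (f : 'I_d -> X -> R) (x xp : X) (s : seq X) : R :=
  ln (1 + \sum_(y <- s) expR (- (dotE f x f xp - dotE f x f y))).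

Definition L_con (k : nat) (f : 'I_d -> X -> R) (D : task) : \bar R :=
  Esample k D (fun x xp s => (con_integrand f x xp s)%:E).

Definition softmax (zs : seq R) : seq R :=
  [seq expR z / \sum_(w <- zs) expR w | z <- zs].

Definition logits (f : 'I_d -> X -> R) (x xp : X) (s : seq X) : seq R :=
  dotE f x f xp :: [seq dotE f x f y | y <- s].

Definition dis_integrand (g h : 'I_d -> X -> R) (x xp : X) (s : seq X) : R :=
  - \sum_(pq <- zip (softmax (logits h x xp s)) (softmax (logits g x xp s)))
      pq.1 * ln pq.2.

Definition L_dis (k : nat) (g h : 'I_d -> X -> R) (D : task) : \bar R :=
  Esample k D (fun x xp s => (dis_integrand g h x xp s)%:E).

Local Open Scope ereal_scope.

Definition L_train (k : nat) (lam : R) (kw : nat -> nat -> R)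
  (fs : nat -> 'I_d -> X -> R) (Ds : nat -> task) (t : nat) : \bar R :=
  L_con k (fs t) (Ds t) +
  lam%:E * \sum_(1 <= j < t) (kw t j)%:E * L_dis k (fs t) (fs t.-1) (Ds j).

Definition L_test (k : nat) (f : 'I_d -> X -> R) (Ds : nat -> task) (T : nat) : \bar R :=
  \sum_(1 <= t < T.+1) L_con k f (Ds t).

Definition inf_con (k : nat) (D : task) : \bar R :=
  ereal_inf [set L_con k f D | f in [set f | is_encoder f]].

End ContrastiveDefs.

Local Open Scope ring_scope.

Definition alphaC {R : realType} (k : nat) : R :=
  2 * expR 2 / (k%:R + expR 2).

Definition gammaC {R : realType} (lam : R) (kw : nat -> nat -> R) (t : nat) : R :=
  \big[Num.min/(t%:R)^-1]_(1 <= j < t) (lam * kw t j).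

Definition gammaC' {R : realType} (lam : R) (kw : nat -> nat -> R) (t : nat) : R :=
  \big[Num.max/1]_(1 <= j < t) (lam * kw t j).

(* Main.v *)
(* Write z_i and w_i for the logits of g and h, and p for the softmax of the w_i.
   Pointwise, con(g) - dis(g; h) = sum_(i >= 1) p_i (z_i - z_0), and unit-norm
   encoders give |z_i - z_0| <= 2, so |con(g) - dis(g; h)| <= 2 (1 - p_0), where
   p_0 = exp(- con(h)).  Bounding 2 (1 - p_0) by a con(h) + const, and from the
   other side using p_0 >= 1 / (1 + k e^2), one gets for every task
     L_con(g) <= L_dis(g; h) + a L_con(h) + const,
     L_con(g) >= L_dis(g; h) + a L_con(h) - const'.
   Summing over the tasks j < t with g = f_t and h = f_(t-1) gives a linear
   recursion in t for the test loss, whose solution is the claim; the factor c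
   is the sum of a^(T-t) (t-1). *)
Require Import Defs.
From HB Require Import structures.
From mathcomp Require Import all_boot all_order all_algebra.
From mathcomp Require Import all_classical all_reals all_analysis.
From mathcomp Require Import measurable_realfun ring lra.
Import Order.TTheory GRing.Theory Num.Theory.
Local Open Scope classical_set_scope.
Local Open Scope ring_scope.

(** * Measurability, monotonicity and linearity of the sampling expectation *)

Section SamplingIntegrals.
Context {R : realType} {dX : measure_display} {X : measurableType dX}.
Implicit Types D : task R X.
Local Open Scope ereal_scope.

(** Classes are countable and discrete, so a preimage is a countable union of rectangles, one per
    class. This gives joint measurability although the family of laws [cdist D] is arbitrary. *)
Lemma measurable_fun_prod_nat dW (W : measurableType dW) dY
    (Y : measurableType dY) (f : W -> nat -> Y) :
  (forall n, measurable_fun setT (f ^~ n)) ->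
  measurable_fun setT (fun p : W * nat => f p.1 p.2).
Proof.
move=> mf _ A mA; rewrite setTI.
have -> : (fun p : W * nat => f p.1 p.2) @^-1` A =
          \bigcup_n ((f ^~ n @^-1` A) `*` [set n]).
  apply/seteqP; split => [[w n] /= Awn|[w n] [m _ [/= Awm ->//]]].
  by exists n.
apply: bigcup_measurable => n _; apply: measurableX => //.
by rewrite -[X in measurable X]setTI; exact: mf.
Qed.

Lemma measurable_mixture D dW (W : measurableType dW) (h : W * X -> \bar R) :
  measurable_fun setT h -> (forall p, 0 <= h p) ->
  measurable_fun setT (fun w => \int[cls D]_c \int[cdist D c]_y h (w, y)).
Proof.
move=> mh h0.
have mF : measurable_fun setT
    (fun p : W * nat => \int[cdist D p.2]_y h (p.1, y)).
  apply: (@measurable_fun_prod_nat _ _ _ _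
    (fun w c => \int[cdist D c]_y h (w, y))) => c.
  exact: (measurable_fun_fubini_tonelli_F (m2 := cdist D c) h).
apply: (measurable_fun_fubini_tonelli_F (m2 := cls D)
  (fun p : W * nat => \int[cdist D p.2]_y h (p.1, y))) => // p.
exact: integral_ge0.
Qed.

(* [seq X] carries no sigma-algebra, so measurability is asked on [n]-tuples. *)
Definition tuple_measurable {dW} {W : measurableType dW} n
    (H : W -> seq X -> \bar R) :=
  measurable_fun setT (fun p : W * n.-tuple X => H p.1 p.2).

(** Inductive step over the negatives: the first one joins the parameter space, which is why every
    induction on [n] below keeps [W] general. *)
Lemma tuple_measurable_cons {dW} {W : measurableType dW} n
    (H : W -> seq X -> \bar R) :
  tuple_measurable n.+1 H ->
  tuple_measurable n (fun (p : W * X) s => H p.1 (p.2 :: s)).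
Proof.
move=> mH; rewrite /tuple_measurable.
have mc : measurable_fun setT (fun q : (W * X) * n.-tuple X =>
    (q.1.1, [the n.+1.-tuple X of q.1.2 :: q.2])).
  apply: measurable_fun_pair.
    exact: (measurableT_comp measurable_fst measurable_fst).
  apply: measurable_cons; last exact: measurable_snd.
  exact: (measurableT_comp measurable_snd measurable_fst).
exact: (measurableT_comp mH mc).
Qed.

Lemma tuple_measurable_comp {dW} {W : measurableType dW} {dV}
    {V : measurableType dV} n (H : W -> seq X -> \bar R) (f : V -> W) :
  measurable_fun setT f -> tuple_measurable n H ->
  tuple_measurable n (fun v => H (f v)).
Proof.
move=> mf mH; rewrite /tuple_measurable.
have mc : measurable_fun setT (fun q : V * n.-tuple X => (f q.1, q.2)).
  apply: measurable_fun_pair; last exact: measurable_snd.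
  exact: measurableT_comp mf measurable_fst.
exact: (measurableT_comp mH mc).
Qed.

Lemma negE_ge0 D n (G : seq X -> \bar R) :
  (forall s, 0 <= G s) -> 0 <= negE D n G.
Proof.
elim: n G => [|n IH] G G0 //=.
by apply: integral_ge0 => c _; apply: integral_ge0 => y _; exact: IH.
Qed.

(** The remaining negatives are integrated by induction with parameter in [W * X]; Tonelli then
    integrates out the first one. *)
Lemma measurable_negE D n dW (W : measurableType dW)
    (H : W -> seq X -> \bar R) :
  tuple_measurable n H -> (forall w s, 0 <= H w s) ->
  measurable_fun setT (fun w => negE D n (H w)).
Proof.
elim: n dW W H => [|n IH] dW W H mH H0 /=.
  have mc : measurable_fun setT (fun w : W => (w, [the 0.-tuple X of [::]])).
    by apply: measurable_fun_pair => //; exact: measurable_cst.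
  exact: (measurableT_comp mH mc).
apply: (@measurable_mixture D _ W
  (fun p => negE D n (fun s => H p.1 (p.2 :: s)))).
  apply: (IH _ _ (fun (p : W * X) s => H p.1 (p.2 :: s))) => //.
  exact: tuple_measurable_cons.
by move=> p; exact: negE_ge0.
Qed.

Lemma measurable_negE_cons D n dW (W : measurableType dW)
    (H : W -> seq X -> \bar R) (w : W) :
  tuple_measurable n.+1 H -> (forall w s, 0 <= H w s) ->
  measurable_fun setT (fun y => negE D n (fun s => H w (y :: s))).
Proof.
move=> mH H0.
apply: (@measurable_negE D n _ X (fun y s => H w (y :: s))) => //.
exact: (@tuple_measurable_comp _ _ _ _ n (fun p s => H p.1 (p.2 :: s))
  (fun y => (w, y))
  (measurable_fun_pair (measurable_cst _) (@measurable_id _ _ _))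
  (@tuple_measurable_cons _ _ n H mH)).
Qed.

Lemma le_negE D n dW (W : measurableType dW) (H1 H2 : W -> seq X -> \bar R) :
  tuple_measurable n H1 -> tuple_measurable n H2 ->
  (forall w s, 0 <= H1 w s) -> (forall w s, 0 <= H2 w s) ->
  (forall w s, size s = n -> H1 w s <= H2 w s) ->
  forall w, negE D n (H1 w) <= negE D n (H2 w).
Proof.
elim: n dW W H1 H2 => [|n IH] dW W H1 H2 m1 m2 p1 p2 le12 w /=.
  exact: le12.
apply: ge0_le_integral => //.
  by move=> c _; apply: integral_ge0 => y _; exact: negE_ge0.
move=> c _; apply: ge0_le_integral => //.
- by move=> y _; exact: negE_ge0.
- exact: measurable_negE_cons.
- exact: measurable_negE_cons.
move=> y _.
apply: (IH _ _ (fun (p : W * X) s => H1 p.1 (p.2 :: s))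
               (fun (p : W * X) s => H2 p.1 (p.2 :: s)) _ _ _ _ _ (w, y)) => //.
- exact: tuple_measurable_cons.
- exact: tuple_measurable_cons.
- by move=> [w' y'] s /= ss; apply: le12; rewrite /= ss.
Qed.

(** Nonnegativity lets each layer of integrals split with no integrability assumption. *)
Lemma negE_linear D n dW (W : measurableType dW)
    (H1 H2 : W -> seq X -> \bar R) (a : R) :
  (0 <= a)%R -> tuple_measurable n H1 -> tuple_measurable n H2 ->
  (forall w s, 0 <= H1 w s) -> (forall w s, 0 <= H2 w s) ->
  forall w, negE D n (fun s => a%:E * H1 w s + H2 w s) =
            a%:E * negE D n (H1 w) + negE D n (H2 w).
Proof.
move=> a0.
elim: n dW W H1 H2 => [//|n IH] dW W H1 H2 m1 m2 p1 p2 w /=.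
have i0 (H : W -> seq X -> \bar R) c : (forall w s, 0 <= H w s) ->
    0 <= \int[cdist D c]_y negE D n (fun s => H w (y :: s)).
  by move=> H0; apply: integral_ge0 => y _; exact: negE_ge0.
rewrite -ge0_integralZl_EFin//; last by move=> c _; exact: i0.
rewrite -ge0_integralD//; last 2 first.
- by move=> c _; apply: mule_ge0 => //; exact: i0.
- by move=> c _; exact: i0.
apply: eq_integral => c _.
rewrite -ge0_integralZl_EFin//; last 2 first.
- by move=> y _; exact: negE_ge0.
- exact: measurable_negE_cons.
rewrite -ge0_integralD//; last 4 first.
- by move=> y _; apply: mule_ge0 => //; exact: negE_ge0.
- by apply: measurable_funeM; exact: measurable_negE_cons.
- by move=> y _; exact: negE_ge0.
- exact: measurable_negE_cons.
apply: eq_integral => y _.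
apply: (IH _ _ (fun (p : W * X) s => H1 p.1 (p.2 :: s))
               (fun (p : W * X) s => H2 p.1 (p.2 :: s)) _ _ _ _ (w, y)) => //.
- exact: tuple_measurable_cons.
- exact: tuple_measurable_cons.
Qed.

Lemma integral_probability_cst dY (Y : measurableType dY)
    (P : probability Y R) (r : \bar R) : \int[P]_y r = r.
Proof.
have := @integral_cst _ _ _ P setT measurableT r; rewrite /cst => ->.
by rewrite -[RHS]mule1; congr (_ * _); exact: probability_setT.
Qed.

Lemma negE_cst D n (r : \bar R) : negE D n (fun=> r) = r.
Proof.
elim: n => //= n ->.
by under eq_integral do rewrite integral_probability_cst;
  rewrite integral_probability_cst.
Qed.

Definition sample_measurable k (F : X -> X -> seq X -> R) :=
  tuple_measurable k (fun (p : X * X) s => (F p.1 p.2 s)%:E).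

Section Esample_theory.
Variables (D : task R X) (k : nat).

Let inner (F : X -> X -> seq X -> R) x xp := negE D k (fun s => (F x xp s)%:E).

Let measurable_inner2 F x : (forall x xp s, (0 <= F x xp s)%R) ->
  sample_measurable k F -> measurable_fun setT (inner F x).
Proof.
move=> F0 mF.
have := @measurable_negE D k _ _ _ mF (fun p s => ltac:(by rewrite lee_fin)).
by move=> m; exact: (measurableT_comp m (measurable_pair1 x)).
Qed.

Let measurable_inner1 F c : (forall x xp s, (0 <= F x xp s)%R) ->
  sample_measurable k F ->
  measurable_fun setT (fun x => \int[cdist D c]_xp inner F x xp).
Proof.
move=> F0 mF.
apply: (measurable_fun_fubini_tonelli_F (m2 := cdist D c)
  (fun p : X * X => inner F p.1 p.2)).
  exact: (@measurable_negE D k _ _ _ mF (fun p s => ltac:(by rewrite lee_fin))).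
by move=> p; apply: negE_ge0 => s; rewrite lee_fin.
Qed.

Let inner_ge0 F x xp : (forall x xp s, (0 <= F x xp s)%R) ->
  0 <= inner F x xp.
Proof. by move=> F0; apply: negE_ge0 => s; rewrite lee_fin. Qed.

Let inner_int_ge0 F c x : (forall x xp s, (0 <= F x xp s)%R) ->
  0 <= \int[cdist D c]_xp inner F x xp.
Proof. by move=> F0; apply: integral_ge0 => xp _; exact: inner_ge0. Qed.

Lemma Esample_ge0 F : (forall x xp s, (0 <= F x xp s)%R) ->
  0 <= Esample k D (fun x xp s => (F x xp s)%:E).
Proof.
by move=> F0; apply: integral_ge0 => c _; apply: integral_ge0 => x _;
  exact: inner_int_ge0.
Qed.

Lemma Esample_cst (r : R) : Esample k D (fun _ _ _ => r%:E) = r%:E.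
Proof.
rewrite /Esample negE_cst.
under eq_integral do (under eq_integral do rewrite integral_probability_cst;
  rewrite integral_probability_cst).
exact: integral_probability_cst.
Qed.

(** The comparison is asked only for lists of length [k] because the uniform bound on the
    contrastive integrand depends on the number of negatives. *)
Lemma le_Esample F G :
  sample_measurable k F -> sample_measurable k G ->
  (forall x xp s, (0 <= F x xp s)%R) -> (forall x xp s, (0 <= G x xp s)%R) ->
  (forall x xp s, size s = k -> (F x xp s <= G x xp s)%R) ->
  Esample k D (fun x xp s => (F x xp s)%:E) <=
  Esample k D (fun x xp s => (G x xp s)%:E).
Proof.
move=> mF mG F0 G0 FG; apply: ge0_le_integral => //.
  by move=> c _; apply: integral_ge0 => x _; exact: inner_int_ge0.
move=> c _; apply: ge0_le_integral => //.
- by move=> x _; exact: inner_int_ge0.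
- exact: measurable_inner1.
- exact: measurable_inner1.
move=> x _; apply: ge0_le_integral => //.
- by move=> xp _; exact: inner_ge0.
- exact: measurable_inner2.
- exact: measurable_inner2.
move=> xp _; apply: (@le_negE D k _ _ _ _ mF mG _ _ _ (x, xp)) => // p s;
  rewrite lee_fin //.
exact: FG.
Qed.

Lemma Esample_linear F G (a : R) : (0 <= a)%R ->
  sample_measurable k F -> sample_measurable k G ->
  (forall x xp s, (0 <= F x xp s)%R) -> (forall x xp s, (0 <= G x xp s)%R) ->
  Esample k D (fun x xp s => (a * F x xp s + G x xp s)%:E) =
  a%:E * Esample k D (fun x xp s => (F x xp s)%:E) +
  Esample k D (fun x xp s => (G x xp s)%:E).
Proof.
move=> a0 mF mG F0 G0; rewrite /Esample.
have i0 H c : (forall x xp s, (0 <= H x xp s)%R) ->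
    0 <= \int[cdist D c]_x \int[cdist D c]_xp inner H x xp.
  by move=> H0; apply: integral_ge0 => x _; exact: inner_int_ge0.
rewrite -ge0_integralZl_EFin//; last by move=> c _; exact: i0.
rewrite -ge0_integralD//; last 2 first.
- by move=> c _; apply: mule_ge0 => //; exact: i0.
- by move=> c _; exact: i0.
apply: eq_integral => c _.
rewrite -ge0_integralZl_EFin//; last 2 first.
- by move=> x _; exact: inner_int_ge0.
- exact: measurable_inner1.
rewrite -ge0_integralD//; last 4 first.
- by move=> x _; apply: mule_ge0 => //; exact: inner_int_ge0.
- by apply: measurable_funeM; exact: measurable_inner1.
- by move=> x _; exact: inner_int_ge0.
- exact: measurable_inner1.
apply: eq_integral => x _.
rewrite -ge0_integralZl_EFin//; last 2 first.
- by move=> xp _; exact: inner_ge0.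
- exact: measurable_inner2.
rewrite -ge0_integralD//; last 4 first.
- by move=> xp _; apply: mule_ge0 => //; exact: inner_ge0.
- by apply: measurable_funeM; exact: measurable_inner2.
- by move=> xp _; exact: inner_ge0.
- exact: measurable_inner2.
apply: eq_integral => xp _.
by apply: (@negE_linear D k _ _ _ _ a a0 mF mG _ _ (x, xp)) => // p s;
  rewrite lee_fin.
Qed.

End Esample_theory.
End SamplingIntegrals.

(** * Pointwise identities and bounds for the two integrands *)

Section PointwiseBounds.
Context {R : realType} {dX : measure_display} {X : measurableType dX} {d : nat}.
Implicit Types (f g h : 'I_d -> X -> R) (x xp y : X) (s : seq X).

(** Both bounds come from expanding the squared norms of f(x) - f(y) and f(x) + f(y), which are
    nonnegative. *)
Lemma encoder_dot_bound f x y : is_encoder f -> -1 <= dotE f x f y <= 1.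
Proof.
move=> [_ f1].
have sqB : \sum_(i < d) (f i x - f i y) ^+ 2 = 2 - 2 * dotE f x f y.
  transitivity (\sum_(i < d) (f i x ^+ 2 + f i y ^+ 2 - 2 * (f i x * f i y))).
    by apply: eq_bigr => i _; ring.
  by rewrite sumrB big_split/= !f1 -mulr_sumr.
have sqD : \sum_(i < d) (f i x + f i y) ^+ 2 = 2 + 2 * dotE f x f y.
  transitivity (\sum_(i < d) (f i x ^+ 2 + f i y ^+ 2 + 2 * (f i x * f i y))).
    by apply: eq_bigr => i _; ring.
  by rewrite !big_split/= !f1 -mulr_sumr.
have : 0 <= \sum_(i < d) (f i x - f i y) ^+ 2 by apply: sumr_ge0 => i _; exact: sqr_ge0.
have : 0 <= \sum_(i < d) (f i x + f i y) ^+ 2 by apply: sumr_ge0 => i _; exact: sqr_ge0.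
by rewrite sqB sqD; lra.
Qed.

Lemma encoder_dotB_bound f x y y' : is_encoder f ->
  -2 <= dotE f x f y - dotE f x f y' <= 2.
Proof.
move=> ef.
have := @encoder_dot_bound f x y ef; have := @encoder_dot_bound f x y' ef; lra.
Qed.

Lemma con_integrand_ge0 f x xp s : 0 <= con_integrand f x xp s.
Proof.
by apply: ln_ge0; rewrite lerDl; apply: sumr_ge0 => y _; exact: expR_ge0.
Qed.

Lemma expR_con_integrand f x xp s : expR (con_integrand f x xp s) =
  1 + \sum_(y <- s) expR (- (dotE f x f xp - dotE f x f y)).
Proof.
rewrite /con_integrand lnK// posrE ltr_pwDl//.
by apply: sumr_ge0 => y _; exact: expR_ge0.
Qed.

Lemma con_integrand_le f x xp s : is_encoder f ->
  con_integrand f x xp s <= ln (1 + (size s)%:R * expR 2).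
Proof.
move=> ef; rewrite /con_integrand ler_ln ?posrE.
- rewrite lerD2l mulr_natl.
  have -> : expR 2 *+ size s = \sum_(y <- s) expR 2 :> R.
    by rewrite big_const_seq count_predT iter_addr_0.
  apply: ler_sum => y _; rewrite ler_expR.
  have := @encoder_dotB_bound f x xp y ef; lra.
- by rewrite ltr_pwDl//; apply: sumr_ge0 => y _; exact: expR_ge0.
- by rewrite ltr_pwDl// mulr_ge0// expR_ge0.
Qed.

(** The normalizer is exp(z_0) exp(con), where z_0 is the logit of the positive. Treating [xp] as
    the head of the list gives one formula for all entries; at the head it reads exp(- con). *)
Lemma softmax_logits f x xp s : softmax (logits f x xp s) =
  [seq expR (dotE f x f y - dotE f x f xp - con_integrand f x xp s)
     | y <- xp :: s].
Proof.
rewrite /softmax (_ : logits f x xp s = [seq dotE f x f y | y <- xp :: s])//.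
rewrite -map_comp; apply: eq_map => y /=.
rewrite !expRD !expRN expR_con_integrand big_cons big_map -mulrA -invfM.
congr (_ / _); rewrite mulrDr mulr1 mulr_sumr; congr (_ + _).
by apply: eq_bigr => z _; rewrite -expRD; congr expR; ring.
Qed.

(** Softmax weights sum to one, and the positive has weight exp(- con). *)
Lemma sum_softmax_negatives f x xp s :
  \sum_(y <- s) expR (dotE f x f y - dotE f x f xp - con_integrand f x xp s) =
  1 - expR (- con_integrand f x xp s).
Proof.
under eq_bigr do rewrite expRD.
rewrite -mulr_suml.
have -> : \sum_(y <- s) expR (dotE f x f y - dotE f x f xp) =
          expR (con_integrand f x xp s) - 1.
  rewrite expR_con_integrand addrC addKr.
  by apply: eq_bigr => y _; rewrite opprB.
by rewrite mulrBl expRN mul1r divff// gt_eqF// expR_gt0.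
Qed.

(** The logarithm of the i-th softmax entry of [g] is z_i - z_0 - con(g). Averaging against the
    weights of [h], whose total is one, isolates con(g), and the positive drops out of the rest
    since its gap is 0. *)
Lemma dis_integrandE g h x xp s : dis_integrand g h x xp s =
  con_integrand g x xp s -
  \sum_(y <- s) expR (dotE h x h y - dotE h x h xp - con_integrand h x xp s) *
                (dotE g x g y - dotE g x g xp).
Proof.
rewrite /dis_integrand !softmax_logits zip_map big_map /=.
rewrite big_cons /= subrr !add0r !expRK.
under eq_bigr do rewrite expRK mulrBr.
rewrite sumrB -mulr_suml sum_softmax_negatives.
ring.
Qed.

(** Every exp(z_y - z_0) is one of the nonnegative summands of exp(con). Equivalently, all softmax
    log-probabilities are nonpositive. *)
Lemma le_con_integrand f x xp s y : y \in xp :: s ->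
  dotE f x f y - dotE f x f xp <= con_integrand f x xp s.
Proof.
rewrite in_cons => /orP[/eqP->|ys]; first by rewrite subrr con_integrand_ge0.
rewrite -ler_expR expR_con_integrand (big_rem y)//= opprB.
rewrite addrCA lerDl addr_ge0//.
by apply: sumr_ge0 => z _; exact: expR_ge0.
Qed.

Lemma dis_integrand_ge0 g h x xp s : 0 <= dis_integrand g h x xp s.
Proof.
rewrite /dis_integrand !softmax_logits zip_map big_map -sumrN big_seq.
apply: sumr_ge0 => y ys /=; rewrite expRK -mulrN mulr_ge0 ?expR_ge0//.
by rewrite oppr_ge0 subr_le0 le_con_integrand.
Qed.

Lemma con_dis_le g h x xp s : is_encoder g ->
  `|con_integrand g x xp s - dis_integrand g h x xp s| <=
  2 * (1 - expR (- con_integrand h x xp s)).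
Proof.
move=> eg; rewrite dis_integrandE opprB addrC subrK -sum_softmax_negatives.
rewrite mulr_sumr (le_trans (ler_norm_sum _ _ _))//.
apply: ler_sum => y _; rewrite normrM ger0_norm ?expR_ge0// mulrC.
by rewrite ler_wpM2r ?expR_ge0// ler_norml encoder_dotB_bound.
Qed.

Lemma measurable_dot f dZ (Z : measurableType dZ) (u v : Z -> X) :
  is_encoder f -> measurable_fun setT u -> measurable_fun setT v ->
  measurable_fun setT (fun z => dotE f (u z) f (v z)).
Proof.
move=> [mf _] mu mv; apply: measurable_sum => i.
by apply: measurable_funM; exact: measurableT_comp.
Qed.

Lemma sample_measurable_con k f :
  is_encoder f -> sample_measurable k (con_integrand f).
Proof.
move=> ef; apply/measurable_EFinP.
rewrite /con_integrand; apply: (measurableT_comp (@measurable_ln R)).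
apply: measurable_funD => //.
under eq_fun do rewrite big_tuple.
apply: measurable_sum => i; apply: (measurableT_comp (@measurable_expR R)).
apply: (measurableT_comp (@oppr_measurable R _)).
apply: measurable_funB; apply: measurable_dot => //.
- exact: (measurableT_comp measurable_fst measurable_fst).
- exact: (measurableT_comp measurable_snd measurable_fst).
- exact: (measurableT_comp measurable_fst measurable_fst).
- exact: (measurableT_comp (measurable_tnth i) measurable_snd).
Qed.

Lemma sample_measurable_dis k g h : is_encoder g -> is_encoder h ->
  sample_measurable k (dis_integrand g h).
Proof.
move=> eg eh; apply/measurable_EFinP.
have mcon f : is_encoder f -> measurable_fun setT
    (fun p : (X * X) * k.-tuple X => con_integrand f p.1.1 p.1.2 p.2).
  by move=> ef; apply/measurable_EFinP; exact: sample_measurable_con.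
have mdot f (ef : is_encoder f) i : measurable_fun setT
    (fun p : (X * X) * k.-tuple X =>
       dotE f p.1.1 f (tnth p.2 i) - dotE f p.1.1 f p.1.2).
  apply: measurable_funB; apply: measurable_dot => //.
  - exact: (measurableT_comp measurable_fst measurable_fst).
  - exact: (measurableT_comp (measurable_tnth i) measurable_snd).
  - exact: (measurableT_comp measurable_fst measurable_fst).
  - exact: (measurableT_comp measurable_snd measurable_fst).
(* In this form only finite sums and products of measurable functions of the tuple coordinates
   remain. *)
under eq_fun do rewrite dis_integrandE big_tuple.
apply: measurable_funB; first exact: mcon.
apply: measurable_sum => i; apply: measurable_funM; last exact: mdot.
apply: (measurableT_comp (@measurable_expR R)).
by apply: measurable_funB; [exact: mdot|exact: mcon].
Qed.

End PointwiseBounds.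

(** * Scalar inequalities in u, the value of the contrastive integrand of h *)

Section Tradeoff.
Context {R : realType}.

(* Tangent line of the exponential at the point where [expR (- u) = a / 2]. *)
Lemma expR_tradeoff_upper (a u : R) : 0 < a ->
  2 * (1 - expR (- u)) <= a * u + (2 - a + a * ln (a / 2)).
Proof.
move=> a0; have a20 : 0 < a / 2 by rewrite divr_gt0.
have : a / 2 * (1 + (- u - ln (a / 2))) <= a / 2 * expR (- u - ln (a / 2)).
  by rewrite ler_pM2l// expR_ge1Dx.
rewrite expRD (expRN (ln _)) lnK ?posrE// mulrCA divff ?gt_eqF// mulr1.
lra.
Qed.

(** Both summands increase with u, so each is bounded by its value at the largest admissible u,
    where exp(- u) = 1 / (1 + k e^2). *)
Lemma expR_tradeoff_lower (a u : R) (k : nat) : 0 <= a ->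
  u <= ln (1 + k%:R * expR 2) ->
  2 * (1 - expR (- u)) + a * u <=
  a * ln (1 + k%:R * expR 2) + 2 * k%:R * expR 2 / (1 + k%:R * expR 2).
Proof.
move=> a0 ub; rewrite addrC lerD ?ler_wpM2l//.
set c := 1 + k%:R * expR 2 in ub *.
have c0 : 0 < c by rewrite ltr_pwDl// mulr_ge0// expR_ge0.
have : c^-1 <= expR (- u).
  by rewrite -[X in X^-1]lnK ?posrE// -expRN ler_expR lerN2.
have -> : 2 * k%:R * expR 2 / c = 2 * (1 - c^-1).
  by rewrite /c in c0 *; field; rewrite gt_eqF.
lra.
Qed.

End Tradeoff.

(** * Finiteness and comparison of the expected losses on one task *)

Section TaskBounds.
Context {R : realType} {dX : measure_display} {X : measurableType dX} {d : nat}.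
Implicit Types (f g h : 'I_d -> X -> R) (D : task R X) (k : nat).

Lemma sample_measurable_linear k (F G : X -> X -> seq X -> R) (a : R) :
  sample_measurable k F -> sample_measurable k G ->
  sample_measurable k (fun x xp s => a * F x xp s + G x xp s).
Proof.
move=> /measurable_EFinP mF /measurable_EFinP mG; apply/measurable_EFinP.
by apply: measurable_funD => //; exact: measurable_funM.
Qed.

Lemma sample_measurable_cst k (r : R) :
  sample_measurable k (fun _ _ _ : _ => r) (X := X).
Proof. exact: measurable_cst. Qed.

Local Open Scope ereal_scope.

Lemma L_con_ge0 k f D : 0 <= L_con k f D.
Proof. exact/Esample_ge0/con_integrand_ge0. Qed.

Lemma L_dis_ge0 k g h D : 0 <= L_dis k g h D.
Proof. exact/Esample_ge0/dis_integrand_ge0. Qed.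

Lemma L_con_fin_num k f D : is_encoder f -> L_con k f D \is a fin_num.
Proof.
move=> ef; rewrite ge0_fin_numE ?L_con_ge0//.
apply: le_lt_trans (ltry (ln (1 + k%:R * expR 2))).
(* A constant is its own expectation, so a pointwise bound suffices. *)
rewrite -[leRHS](Esample_cst D k); apply: le_Esample.
- exact: sample_measurable_con.
- exact: sample_measurable_cst.
- exact: con_integrand_ge0.
- by move=> *; apply: ln_ge0; rewrite lerDl mulr_ge0// expR_ge0.
- by move=> x xp s <-; exact: con_integrand_le.
Qed.

Lemma L_con_upper k g h D (a : R) : is_encoder g -> is_encoder h -> (0 < a)%R ->
  L_con k g D <=
  L_dis k g h D + (a%:E * L_con k h D + (2 - a + a * ln (a / 2))%:E).
Proof.
move=> eg eh a0; set b := (2 - a + a * ln (a / 2))%R.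
(* Monotonicity and linearity of [Esample] ask for nonnegative integrands; the sign of the constant
   is the tangent-line inequality at u = 0. *)
have b0 : (0 <= b)%R.
  by have := expR_tradeoff_upper a 0 a0; rewrite oppr0 expR0 subrr !mulr0 add0r.
have mh := sample_measurable_con k h eh.
have mb := @sample_measurable_cst k b.
have mhb := sample_measurable_linear _ _ _ a mh mb.
have md := sample_measurable_dis k g h eg eh.
have hb0 x xp s : (0 <= a * con_integrand h x xp s + b)%R.
  by rewrite addr_ge0// mulr_ge0 ?con_integrand_ge0// ltW.
(* The right side becomes a single expectation; the factor 1 fits the shape of [Esample_linear]. *)
have <- : Esample k D (fun x xp s => (1 * dis_integrand g h x xp s +
      (a * con_integrand h x xp s + b))%:E) =
    L_dis k g h D + (a%:E * L_con k h D + b%:E).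
  rewrite (Esample_linear D k (dis_integrand g h)
    (fun x xp s => a * con_integrand h x xp s + b)%R 1)//; last first.
    exact: dis_integrand_ge0.
  rewrite mul1e (Esample_linear D k (con_integrand h) (fun _ _ _ => b) a)//.
  - by rewrite Esample_cst.
  - exact: ltW.
  - exact: con_integrand_ge0.
apply: le_Esample => //.
- exact: sample_measurable_con.
- exact: sample_measurable_linear.
- exact: con_integrand_ge0.
- by move=> x xp s; rewrite mul1r addr_ge0// dis_integrand_ge0.
move=> x xp s _; rewrite mul1r.
have := expR_tradeoff_upper a (con_integrand h x xp s) a0.
have := con_dis_le g h x xp s eg; rewrite ler_norml -/b.
lra.
Qed.

(** The constant stands on the right so that both sides are expectations of nonnegative
    integrands. *)
Lemma L_con_lower k g h D (a : R) : is_encoder g -> is_encoder h -> (0 < a)%R ->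
  a%:E * L_con k h D + L_dis k g h D <=
  L_con k g D + (a * ln (1 + k%:R * expR 2) +
                 2 * k%:R * expR 2 / (1 + k%:R * expR 2))%:E.
Proof.
move=> eg eh a0; set b := (a * ln _ + _)%R.
have b0 : (0 <= b)%R.
  have ke0 : (0 <= k%:R * expR 2 :> R)%R by rewrite mulr_ge0// expR_ge0.
  apply: addr_ge0; first by rewrite mulr_ge0 ?(ltW a0)// ln_ge0// lerDl.
  by apply: divr_ge0; [rewrite -mulrA mulr_ge0|rewrite addr_ge0].
have mh := sample_measurable_con k h eh.
have mg := sample_measurable_con k g eg.
have mb := @sample_measurable_cst k b.
have md := sample_measurable_dis k g h eg eh.
have <- : Esample k D (fun x xp s =>
      (a * con_integrand h x xp s + dis_integrand g h x xp s)%:E) =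
    a%:E * L_con k h D + L_dis k g h D.
  rewrite (Esample_linear D k (con_integrand h) (dis_integrand g h) a)//.
  - exact: ltW.
  - exact: con_integrand_ge0.
  - exact: dis_integrand_ge0.
have <- : Esample k D (fun x xp s => (1 * con_integrand g x xp s + b)%:E) =
    L_con k g D + b%:E.
  rewrite (Esample_linear D k (con_integrand g) (fun _ _ _ => b) 1)//.
    by rewrite mul1e Esample_cst.
  exact: con_integrand_ge0.
apply: le_Esample => //.
- exact: sample_measurable_linear.
- exact: sample_measurable_linear.
- move=> x xp s; rewrite addr_ge0 ?dis_integrand_ge0//.
  by rewrite mulr_ge0 ?con_integrand_ge0// ltW.
- by move=> x xp s; rewrite addr_ge0// mul1r con_integrand_ge0.
move=> x xp s sk; rewrite mul1r.
have := con_integrand_le h x xp s eh; rewrite sk => hle.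
have := expR_tradeoff_lower a _ k (ltW a0) hle; rewrite -/b.
have := con_dis_le g h x xp s eg; rewrite ler_norml.
lra.
Qed.

(** The lower bound at a = 1 dominates the distillation loss by a finite contrastive loss plus a
    constant. *)
Lemma L_dis_fin_num k g h D :
  is_encoder g -> is_encoder h -> L_dis k g h D \is a fin_num.
Proof.
move=> eg eh; rewrite ge0_fin_numE ?L_dis_ge0//.
have := @L_con_lower k g h D 1 eg eh ltr01; rewrite mul1e.
move=> le; apply: (@le_lt_trans _ _ (L_con k h D + L_dis k g h D)).
  by rewrite leeDr// L_con_ge0.
apply: (le_lt_trans le).
by rewrite -(fineK (L_con_fin_num k g D eg)) -EFinD ltry.
Qed.

(** An encoder bounds the infimum from above by a finite loss, and 0 bounds it from below; over an
    empty set it would be [+oo]. *)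
Lemma inf_con_fin_num k D : (exists f, @is_encoder R dX X d f) ->
  inf_con d k D \is a fin_num.
Proof.
move=> [f ef]; rewrite ge0_fin_numE.
  apply: (@le_lt_trans _ _ (L_con k f D)).
    by apply: ereal_inf_lbound; exists f.
  by rewrite -ge0_fin_numE ?L_con_ge0// L_con_fin_num.
by apply: le_ereal_inf_tmp => _ [g _ <-]; exact: L_con_ge0.
Qed.

End TaskBounds.

(** * One step of the recursion in t, and its solution, in real numbers *)

Section Recursion.
Context {R : realFieldType}.

Lemma unroll_recursion_le (a : R) (S b : nat -> R) (T : nat) : 0 <= a ->
  (1 <= T)%N ->
  (forall t, (2 <= t <= T)%N -> S t <= a * S t.-1 + b t) ->
  S T <= a ^+ (T - 1) * S 1%N + \sum_(2 <= t < T.+1) a ^+ (T - t) * b t.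
Proof.
move=> a0; case: T => // T _; elim: T => [|T IH] Sle.
  by rewrite big_geq// addr0 mul1r.
rewrite big_nat_recr//= subnn mul1r addrA.
apply: (le_trans (Sle T.+2 (leqnn _))); rewrite lerD2r /=.
have -> : a ^+ (T.+2 - 1) * S 1%N +
    \sum_(2 <= t < T.+2) a ^+ (T.+2 - t) * b t =
    a * (a ^+ (T.+1 - 1) * S 1%N +
    \sum_(2 <= t < T.+2) a ^+ (T.+1 - t) * b t).
  rewrite mulrDr mulrA -exprS !subSS !subn0 mulr_sumr; congr (_ + _).
  apply: eq_big_nat => t /andP[_ tT].
  (* Since [t <= T.+1], the truncated difference [T.+2 - t] is the successor of [T.+1 - t]. *)
  by rewrite mulrA -exprS -subSn.
apply: ler_wpM2l => //; apply: IH => t /andP[t2 tT].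
by apply: Sle; rewrite t2 ltnW.
Qed.

(** Both sides vanish at T = 1 and satisfy x_(T+1) = a x_T + T. The weight t - 1 counts the earlier
    tasks, each adding one constant at step t. *)
Lemma sum_weighted_geometric (a : R) (T : nat) : (1 <= T)%N -> a != 1 ->
  \sum_(2 <= t < T.+1) a ^+ (T - t) * (t%:R - 1) =
  (T%:R - 1 - T%:R * a + a ^+ T) / (1 - a) ^+ 2.
Proof.
case: T => // T _ a1.
have a1' : 1 - a != 0 by rewrite subr_eq0 eq_sym.
elim: T => [|T IH].
  by rewrite big_geq// subrr mul1r sub0r expr1 addNr mul0r.
rewrite big_nat_recr//= subnn mul1r.
have -> : \sum_(2 <= t < T.+2) a ^+ (T.+2 - t) * (t%:R - 1) =
    a * \sum_(2 <= t < T.+2) a ^+ (T.+1 - t) * (t%:R - 1).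
  rewrite mulr_sumr; apply: eq_big_nat => t /andP[_ tT].
  by rewrite mulrA -exprS -subSn.
by rewrite IH !exprS -!natr1; field.
Qed.

(** [A] and [A'] stand for the losses of the new and the previous encoder on earlier tasks, [E] for
    distillation, [C] for the loss on the current task, [I] for its infimum. As [gam] is at most
    every [lam * w j], dividing by it recovers the unweighted sum of [E]. *)
Lemma upper_step (a b gam lam C I : R) (t : nat) (A A' E w : nat -> R) :
  (1 <= t)%N -> 0 < gam -> gam <= 1 -> I <= C ->
  (forall j, (1 <= j < t)%N -> gam <= lam * w j) ->
  (forall j, (1 <= j < t)%N -> 0 <= E j) ->
  (forall j, (1 <= j < t)%N -> A j <= E j + (a * A' j + b)) ->
  \sum_(1 <= j < t) A j + C <=
  a * \sum_(1 <= j < t) A' j +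
  (gam^-1 * (C + lam * \sum_(1 <= j < t) w j * E j) + (1 - gam^-1) * I +
   b * (t%:R - 1)).
Proof.
move=> t1 g0 g1 IC gle E0 Ale.
have sumA : \sum_(1 <= j < t) A j <=
    \sum_(1 <= j < t) E j + (a * \sum_(1 <= j < t) A' j + b * (t%:R - 1)).
  apply: (le_trans (ler_sum_nat Ale)).
  rewrite !big_split/= -mulr_sumr sumr_const_nat.
  by rewrite -(natrB _ t1) mulr_natr.
have sumE : \sum_(1 <= j < t) E j <=
    gam^-1 * (lam * \sum_(1 <= j < t) w j * E j).
  rewrite ler_pdivlMl// !mulr_sumr; apply: ler_sum_nat => j jt.
  by rewrite mulrA ler_wpM2r ?E0// gle.
(* Splitting C = C / gam + (1 - 1/gam) C, the last coefficient is nonpositive, so C there may be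
   replaced by the smaller I. *)
have : 0 <= (gam^-1 - 1) * (C - I).
  by rewrite mulr_ge0// subr_ge0// invf_ge1.
lra.
Qed.

(** Here [gam] dominates 1 and every [lam * w j], so dividing the training loss by it only lowers
    each nonnegative term. *)
Lemma lower_step (a b gam lam C : R) (t : nat) (A A' E w : nat -> R) :
  (1 <= t)%N -> 1 <= gam -> 0 <= C ->
  (forall j, (1 <= j < t)%N -> lam * w j <= gam) ->
  (forall j, (1 <= j < t)%N -> 0 <= E j) ->
  (forall j, (1 <= j < t)%N -> a * A' j + E j <= A j + b) ->
  a * \sum_(1 <= j < t) A' j +
  (gam^-1 * (C + lam * \sum_(1 <= j < t) w j * E j) - b * (t%:R - 1)) <=
  \sum_(1 <= j < t) A j + C.
Proof.
move=> t1 g1 C0 gle E0 Ale.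
have g0 : 0 < gam by exact: lt_le_trans g1.
have sumA : a * \sum_(1 <= j < t) A' j + \sum_(1 <= j < t) E j <=
    \sum_(1 <= j < t) A j + b * (t%:R - 1).
  have := ler_sum_nat Ale.
  rewrite !big_split/= -mulr_sumr sumr_const_nat.
  by rewrite -(natrB _ t1) mulr_natr.
have sumE : gam^-1 * (lam * \sum_(1 <= j < t) w j * E j) <=
    \sum_(1 <= j < t) E j.
  rewrite ler_pdivrMl// !mulr_sumr; apply: ler_sum_nat => j jt.
  by rewrite mulrA ler_wpM2r ?E0// gle.
have : 0 <= (1 - gam^-1) * C.
  by rewrite mulr_ge0// subr_ge0// invf_le1.
lra.
Qed.

End Recursion.

(** * Numerical bounds on e^2, and elementary facts about alpha and the two gammas *)

Section Constants.
Context {R : realType}.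

(** One squaring step; [c'] leaves room to round the squared bound down to a simpler fraction. *)
Lemma expR_double_gt (c c' x : R) :
  0 <= c -> c' <= c ^+ 2 -> c < expR x -> c' < expR (x *+ 2).
Proof.
move=> c0 c'c cx; rewrite mulr2n expRD (le_lt_trans c'c)// expr2.
by rewrite ltr_pM.
Qed.

(* [(1 + 1/32)^64 < e^2 < (1 - 1/32)^(-64)], by repeated squaring, rounding
   down to small fractions. *)
Lemma expR2_gt7 : 7 < expR 2 :> R.
Proof.
have e0 : 33 / 32 < expR (32^-1) :> R.
  by apply: le_lt_trans (expR_gt1Dx _); [lra|rewrite invr_neq0].
have e1 := @expR_double_gt (33 / 32) (151 / 142) _ ltac:(lra) ltac:(lra) e0.
have e2 := @expR_double_gt (151 / 142) (147 / 130) _ ltac:(lra) ltac:(lra) e1.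
have e3 := @expR_double_gt (147 / 130) (179 / 140) _ ltac:(lra) ltac:(lra) e2.
have e4 := @expR_double_gt (179 / 140) (273 / 167) _ ltac:(lra) ltac:(lra) e3.
have e5 := @expR_double_gt (273 / 167) (473 / 177) _ ltac:(lra) ltac:(lra) e4.
have e6 := @expR_double_gt (473 / 177) 7 _ ltac:(lra) ltac:(lra) e5.
by move: e6; rewrite -!mulrnA; congr (_ < expR _); rewrite -mulr_natr /=; field.
Qed.

Lemma expR2_lt8 : expR 2 < 8 :> R.
Proof.
have e0 : 31 / 32 < expR (- 32^-1) :> R.
  by apply: le_lt_trans (expR_gt1Dx _); [lra|rewrite oppr_eq0 invr_neq0].
have e1 := @expR_double_gt (31 / 32) (61 / 65) _ ltac:(lra) ltac:(lra) e0.
have e2 := @expR_double_gt (61 / 65) (155 / 176) _ ltac:(lra) ltac:(lra) e1.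
have e3 := @expR_double_gt (155 / 176) (38 / 49) _ ltac:(lra) ltac:(lra) e2.
have e4 := @expR_double_gt (38 / 49) (86 / 143) _ ltac:(lra) ltac:(lra) e3.
have e5 := @expR_double_gt (86 / 143) (64 / 177) _ ltac:(lra) ltac:(lra) e4.
have e6 := @expR_double_gt (64 / 177) (8^-1) _ ltac:(lra) ltac:(lra) e5.
(* Six doublings of -1/32 reach -2, so [e6] says 1/8 < e^(-2), and inverting gives the claim. *)
rewrite -ltf_pV2 ?posrE ?expR_gt0// -expRN.
by move: e6; rewrite -!mulrnA; congr (_ < expR _); rewrite -mulr_natr /=; field.
Qed.

(* [alphaC k = 1] would force [e^2 = k]. *)
Lemma alphaC_neq1 k : alphaC k != 1 :> R.
Proof.
apply/eqP => a1.
have ek : expR 2 = k%:R :> R.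
  have kn0 : k%:R + expR 2 != 0 :> R by rewrite gt_eqF// ltr_wpDl ?expR_gt0.
  move: a1 => /(congr1 ( *%R^~ (k%:R + expR 2))).
  by rewrite /alphaC mulfVK// mul1r; lra.
have := expR2_lt8; have := expR2_gt7; rewrite ek !ltr_nat => k7 k8.
by move: (leq_trans k7 k8); rewrite ltnn.
Qed.

Lemma alphaC_gt0 k : 0 < alphaC k :> R.
Proof. by rewrite divr_gt0 ?mulr_gt0 ?expR_gt0// ltr_wpDl ?expR_gt0. Qed.

Lemma gammaC_gt0 (lam : R) kw t : 0 < lam -> (1 <= t)%N ->
  (forall j, (1 <= j < t)%N -> 0 < kw t j) -> 0 < gammaC lam kw t.
Proof.
move=> l0 t1 kw0; rewrite /gammaC big_nat_cond.
elim/big_ind: _ => [|x y x0 y0|j /andP[jt _]].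
- by rewrite invr_gt0 ltr0n.
- by rewrite lt_min x0.
- by rewrite mulr_gt0// kw0.
Qed.

Lemma gammaC_le_inv (lam : R) kw t : gammaC lam kw t <= t%:R^-1.
Proof. exact: bigmin_le_id. Qed.

Lemma gammaC_le (lam : R) kw t j : (1 <= j < t)%N ->
  gammaC lam kw t <= lam * kw t j.
Proof. by move=> jt; apply: bigmin_inf_seq (lexx _) => //; rewrite mem_index_iota. Qed.

Lemma gammaC'_ge1 (lam : R) kw t : 1 <= gammaC' lam kw t.
Proof. exact: bigmax_ge_id. Qed.

Lemma gammaC'_ge (lam : R) kw t j : (1 <= j < t)%N ->
  lam * kw t j <= gammaC' lam kw t.
Proof.
move=> jt; rewrite /gammaC'.
apply: (le_bigmax_seq _ j xpredT (fun i => lam * kw t i)) => //.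
by rewrite mem_index_iota.
Qed.

End Constants.

(** * Assembly of the two bounds on the test loss *)

Theorem theorem3 (R : realType) (dX : measure_display) (X : measurableType dX)
  (d : nat) (k T : nat) (Ds : nat -> task R X) (fs : nat -> 'I_d -> X -> R)
  (lam : R) (kw : nat -> nat -> R) :
  (0 < d)%N -> (1 <= k)%N -> (2 <= T)%N ->
  (forall t, (1 <= t <= T)%N -> is_encoder (fs t)) ->
  0 < lam ->
  (forall t j, (2 <= t <= T)%N -> (1 <= j < t)%N -> 0 < kw t j) ->
  (forall t, (2 <= t <= T)%N -> \sum_(1 <= j < t) kw t j = 1) ->
  let a : R := alphaC k in
  let c : R := (T%:R - 1 - T%:R * a + a ^+ T) / (1 - a) ^+ 2 in
  let eta : \bar R :=
    (((2 - a + a * ln (a / 2)) * c)%:E +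
     \sum_(2 <= t < T.+1)
        ((a ^+ (T - t) * (1 - (gammaC lam kw t)^-1))%:E * inf_con d k (Ds t)))%E in
  let eta' : \bar R :=
    (- ((a * ln (1 + k%:R * expR 2) + 2 * k%:R * expR 2 / (1 + k%:R * expR 2)) * c))%:E in
  (L_test k (fs T) Ds T <=
     (a ^+ (T - 1))%:E * L_con k (fs 1%N) (Ds 1%N) +
     \sum_(2 <= t < T.+1)
        ((a ^+ (T - t) / gammaC lam kw t)%:E * L_train k lam kw fs Ds t) +
     eta)%E /\
  (L_test k (fs T) Ds T >=
     (a ^+ (T - 1))%:E * L_con k (fs 1%N) (Ds 1%N) +
     \sum_(2 <= t < T.+1)
        ((a ^+ (T - t) / gammaC' lam kw t)%:E * L_train k lam kw fs Ds t) +
     eta')%E.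
Proof.
move=> d0 k1 T2 encs lam0 kw0 _ a c eta eta'.
have a0 : 0 < a := alphaC_gt0 k.
have T1 : (1 <= T)%N := ltnW T2.
pose b : R := 2 - a + a * ln (a / 2).
pose b' : R := a * ln (1 + k%:R * expR 2) + 2 * k%:R * expR 2 / (1 + k%:R * expR 2).
(* All losses involved are finite, so the recursion runs on their real values; its unknown is [S t],
   the test loss of [fs t] over the first t tasks. *)
pose A t j := fine (L_con k (fs t) (Ds j)).
pose E t j := fine (L_dis k (fs t) (fs t.-1) (Ds j)).
pose I t := fine (inf_con d k (Ds t)).
pose Tr t := A t t + lam * \sum_(1 <= j < t) kw t j * E t j.
pose S t := \sum_(1 <= j < t.+1) A t j.
have range_pred t : (2 <= t <= T)%N -> (1 <= t.-1 <= T)%N.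
  by case: t => // t; rewrite ltnS => /andP[t1 tT]; rewrite t1 ltnW.
have range t : (2 <= t <= T)%N -> (1 <= t <= T)%N.
  by move=> /andP[t2 ->]; rewrite ltnW.
have enc_pred t : (2 <= t <= T)%N -> is_encoder (fs t.-1).
  by move=> /range_pred; exact: encs.
have enc t : (2 <= t <= T)%N -> is_encoder (fs t) by move=> /range; exact: encs.
have AE t j : (1 <= t <= T)%N -> L_con k (fs t) (Ds j) = (A t j)%:E.
  by move=> tT; rewrite fineK// L_con_fin_num//; exact: encs.
have EE t j : (2 <= t <= T)%N ->
    L_dis k (fs t) (fs t.-1) (Ds j) = (E t j)%:E.
  by move=> tT; rewrite fineK// L_dis_fin_num//; [exact: enc|exact: enc_pred].
have IE t : inf_con d k (Ds t) = (I t)%:E.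
  rewrite fineK// inf_con_fin_num//.
  by exists (fs 1%N); apply: encs; rewrite T1.
have TrE t : (2 <= t <= T)%N -> L_train k lam kw fs Ds t = (Tr t)%:E.
  move=> tT; rewrite /L_train AE; last exact: range.
  rewrite EFinD EFinM -sumEFin; congr (_ + _ * _)%E.
  by apply: eq_bigr => j _; rewrite EE.
have A_ge0 t j : 0 <= A t j by rewrite fine_ge0// L_con_ge0.
have E_ge0 t j : 0 <= E t j by rewrite fine_ge0// L_dis_ge0.
have SE t : (1 <= t)%N -> S t = \sum_(1 <= j < t) A t j + A t t.
  by move=> t1; rewrite /S big_nat_recr.
have SpE t : (1 <= t)%N -> S t.-1 = \sum_(1 <= j < t) A t.-1 j.
  by move=> t1; rewrite /S prednK.
have S1 : S 1%N = A 1%N 1%N by rewrite /S big_nat1.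
have testE : L_test k (fs T) Ds T = (S T)%:E.
  by rewrite /L_test -sumEFin; apply: eq_bigr => j _; rewrite AE// T1 leqnn.
(* These four are now known only through the equations above; [Tr] stays transparent so that it
   unfolds to the shape in the step lemmas. *)
clearbody S A E I.
have up t : (2 <= t <= T)%N -> S t <= a * S t.-1 +
    ((gammaC lam kw t)^-1 * Tr t + (1 - (gammaC lam kw t)^-1) * I t +
     b * (t%:R - 1)).
  move=> tT; have [t2 _] := andP tT.
  have t1 : (1 <= t)%N := ltnW t2.
  rewrite (SE t t1) (SpE t t1); apply: (upper_step a b (gammaC lam kw t) lam (A t t) (I t) t
    (A t) (A t.-1) (E t) (kw t)) => [//|||||//|].
  - by apply: gammaC_gt0 => // j; exact: kw0.
  - by apply: (le_trans (gammaC_le_inv _ _ _)); rewrite invf_le1 ?ltr0n// ler1n.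
  (* The encoder [fs t] itself competes in the infimum. *)
  - rewrite -lee_fin -IE -AE; last exact: range.
    by apply: ereal_inf_lbound; exists (fs t) => //; exact: enc.
  - by move=> j; exact: gammaC_le.
  - move=> j _; rewrite -lee_fin !EFinD EFinM -EE// -!AE//; last 2 first.
    + exact: range_pred.
    + exact: range.
    by apply: L_con_upper => //; [exact: enc|exact: enc_pred].
have low t : (2 <= t <= T)%N -> a * S t.-1 +
    ((gammaC' lam kw t)^-1 * Tr t - b' * (t%:R - 1)) <= S t.
  move=> tT; have [t2 _] := andP tT.
  have t1 : (1 <= t)%N := ltnW t2.
  rewrite (SE t t1) (SpE t t1); apply: (lower_step a b' (gammaC' lam kw t) lam (A t t) t
    (A t) (A t.-1) (E t) (kw t)) => [//||//||//|].
  - exact: gammaC'_ge1.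
  - by move=> j; exact: gammaC'_ge.
  - move=> j _; rewrite -lee_fin !EFinD EFinM -EE// -!AE//; last 2 first.
    + exact: range.
    + exact: range_pred.
    by apply: L_con_lower => //; [exact: enc|exact: enc_pred].
have cE : \sum_(2 <= t < T.+1) a ^+ (T - t) * (t%:R - 1) = c.
  by apply: sum_weighted_geometric => //; exact: alphaC_neq1.
have trainE (w : nat -> R) :
    (\sum_(2 <= t < T.+1) ((w t)%:E * L_train k lam kw fs Ds t) =
     (\sum_(2 <= t < T.+1) w t * Tr t)%:E)%E.
  rewrite -sumEFin; apply: eq_big_nat => t tT.
  by rewrite EFinM TrE.
rewrite testE AE ?T1// !trainE; split.
- rewrite /eta (eq_bigr (fun t =>
    (a ^+ (T - t) * (1 - (gammaC lam kw t)^-1) * I t)%:E)); last first.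
    by move=> t _; rewrite IE EFinM.
  rewrite sumEFin -!EFinM -!EFinD lee_fin.
  have := unroll_recursion_le a S _ T (ltW a0) T1 up.
  move=> /le_trans; apply; rewrite S1 -/b -cE mulr_sumr -!addrA lerD2l.
  (* With the constant spread over t by [cE], both sides are sums over the same range and agree term
     by term. *)
  rewrite addrCA -!big_split/= le_eqVlt; apply/orP; left; apply/eqP.
  by apply: eq_bigr => t _; ring.
- rewrite /eta' -!EFinM -!EFinD lee_fin.
  (* Negation turns the lower recursion into an upper one for - S, so the same unrolling lemma
     applies. *)
  have upN t : (2 <= t <= T)%N -> - S t <= a * - S t.-1 +
      (b' * (t%:R - 1) - (gammaC' lam kw t)^-1 * Tr t).
    by move=> /low; rewrite mulrN; lra.
  have := unroll_recursion_le a (fun t => - S t) _ T (ltW a0) T1 upN.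
  rewrite S1 lerNl; apply: le_trans.
  rewrite -/b' -cE mulr_sumr mulrN opprD opprK -addrA lerD2l -sumrN.
  rewrite -sumrN -big_split/= le_eqVlt; apply/orP; left; apply/eqP.
  by apply: eq_bigr => t _; ring.
Qed.
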